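(* Let $\mathcal{T}_h$ be a simplicial mesh of $\Omega$. If $\mathcal{T}_h$ satisfies the anisotropic non-obtuse angle condition $$(\boldsymbol{q}_i^K)^T\, \mathbb{D}_K\, \boldsymbol{q}_j^K \le 0,\qquad \forall\, i\ne j,\; i,j=1,2,\dots,d+1,\quad \forall K\in\mathcal{T}_h,$$ then the linear finite element scheme for the boundary value problem $-\nabla\cdot(\mathbb{D}\nabla u)=f$ in $\Omega$, $u=g$ on $\partial\Omega$ (as defined in the context, with quadrature) satisfies the discrete maximum principle (DMP).
   Context: Problem. $d\in\{1,2,3\}$; $\Omega\subset\mathbb{R}^d$ is a connected (bounded) interval, polygon or polyhedron; $f$ and $g$ are given functions; $\mathbb{D}=\mathbb{D}(\boldsymbol{x})$ is a $d\times d$ diffusion matrix, symmetric and strictly positive definite on $\Omega$. The boundary value problem is $-\nabla\cdot(\mathbb{D}\nabla u)=f$ in $\Omega$, $u=g$ on $\partial\Omega$. Mesh. $\mathcal{T}_h$ is a simplicial triangulation of $\Omega$ with $N_v$ vertices $\boldsymbol{a}_1,\dots,\boldsymbol{a}_{N_v}$, ordered so that the first $N_{vi}$ are the interior ones and the remaining ones lie on $\partial\Omega$. $\phi_j$ is the continuous piecewise linear basis function of the vertex $\boldsymbol{a}_j$. $\hat K$ is a fixed reference simplex; for $K\in\mathcal{T}_h$, $F_K$ is the affine map with $K=F_K(\hat K)$; $|K|$ is the volume of $K$. Quadrature. A quadrature rule $\int_{\hat K} v\,d\xi\approx|\hat K|\sum_{k=1}^m\hat w_k v(\hat b_k)$ on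 $\hat K$, with weights $\hat w_k$ satisfying $\sum_{k=1}^m\hat w_k=1$ and quadrature nodes $\hat b_k$, is fixed. Put $b_k^K=F_K(\hat b_k)$ and $\mathbb{D}_K=\sum_{k=1}^m\hat w_k\,\mathbb{D}(b_k^K)$. Scheme. Let $U_0^h=\mathrm{span}\{\phi_1,\dots,\phi_{N_{vi}}\}$. The linear finite element scheme is: find $u^h=\sum_{j=1}^{N_v}u_j\phi_j$ with $u_j=g(\boldsymbol{a}_j)$ for $j=N_{vi}+1,\dots,N_v$ such that $$\sum_{K\in\mathcal{T}_h}|K|\,(\nabla v^h|_K)^T\mathbb{D}_K\nabla u^h|_K=\sum_{K\in\mathcal{T}_h}|K|\sum_{k=1}^m\hat w_k f(b_k^K)\,v^h(b_k^K)\qquad\forall v^h\in U_0^h.$$ DMP. The discrete maximum principle is the discrete counterpart of the maximum principle of the continuous problem: whenever $f(\boldsymbol{x})\le0$ for all $\boldsymbol{x}\in\Omega$, the solution of the scheme satisfies $\max_{\boldsymbol{x}\in\Omega\cup\partial\Omega}u^h(\boldsymbol{x})\le\max\{0,\max_{\boldsymbol{s}\in\partial\Omega}u^h(\boldsymbol{s})\}$. $\boldsymbol{q}$-vectors. For $K\in\mathcal{T}_h$ with vertices $\boldsymbol{a}_1^K,\dots,\boldsymbol{a}_{d+1}^K$, let $E_K=[\boldsymbol{a}_2^K-\boldsymbol{a}_1^K,\dots,\boldsymbol{a}_{d+1}^K-\boldsymbol{a}_1^K]$ (a nonsingular $d\times d$ matrix) and define column vectors by $[\boldsymbol{q}_2^K,\dots,\boldsymbol{q}_{d+1}^K]=E_K^{-T}$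 and $\boldsymbol{q}_1^K=-\sum_{i=2}^{d+1}\boldsymbol{q}_i^K$.
   Formalization: The quadrature weights are additionally assumed nonnegative (with negative weights the load of some f ≤ 0 can be positive and the DMP fails), and D is assumed symmetric positive definite also at quadrature nodes lying on the boundary of Ω. *)

(* Defs.v *)
From HB Require Import structures.
From mathcomp Require Import all_boot all_order all_algebra.
From mathcomp Require Import all_classical all_reals all_analysis.

Set Implicit Arguments.
Unset Strict Implicit.
Unset Printing Implicit Defensive.

Import Order.TTheory GRing.Theory Num.Theory.
Import numFieldNormedType.Exports.

Local Open Scope classical_set_scope.
Local Open Scope ring_scope.

(** * Geometry *)

Definition conv_hull (R : realType) (d : nat) (I : finType)
    (a : I -> 'cV[R]_d) (S : {set I}) : set 'cV[R]_d :=
  [set x | exists c : I -> R, [/\ forall i, 0 <= c i,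
    \sum_(i in S) c i = 1 & x = \sum_(i in S) c i *: a i]].

(** [p_1 - p_0, ..., p_d - p_0], as columns *)
Definition edge_mx (R : realType) (d : nat) (p : 'I_d.+1 -> 'cV[R]_d)
    : 'M[R]_d :=
  \matrix_(r, s) (p (lift ord0 s) - p ord0) r 0.

Definition bdry (T : topologicalType) (A : set T) : set T :=
  closure A `\` interior A.

(** A bounded interval, polygon or polyhedron, as an open set: regularity
    (Omega is the interior of its closure) excludes slits and missing points. *)
Definition polyhedral_domain (R : realType) (d : nat) (Omega : set 'cV[R]_d) :=
  [/\ Omega !=set0, connected Omega, interior (closure Omega) = Omega &
    exists (n : nat) (p : 'I_n -> 'I_d.+1 -> 'cV[R]_d),
      (forall k, edge_mx (p k) \in unitmx) /\
      closure Omega = \bigcup_(k in [set: 'I_n]) conv_hull (p k) finset.setT].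

Definition spd (R : realType) (d : nat) (A : 'M[R]_d) : Prop :=
  A^T = A /\ forall x : 'cV[R]_d, x != 0 -> 0 < (x^T *m A *m x) 0 0.

Definition affine_map (R : realType) (d : nat) (F : 'cV[R]_d -> 'cV[R]_d) :=
  exists (M : 'M[R]_d) (t : 'cV[R]_d), forall x, F x = M *m x + t.

Definition affine_on (R : realType) (d : nat) (A : set 'cV[R]_d)
    (v : 'cV[R]_d -> R) :=
  exists (G : 'cV[R]_d) (c : R), forall x, A x -> v x = (G^T *m x) 0 0 + c.

Definition is_maximum (R : realType) (A : set R) (m : R) : Prop :=
  A m /\ ubound A m.

(** * Simplicial meshes *)

(** [cell K] lists the indices of the vertices of the simplex K, in some order;
    the vertices numbered below [nvi] are the interior ones. *)
Record mesh (R : realType) (d : nat) := Mesh {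
  nv : nat;
  nvi : nat;
  ncell : nat;
  node : 'I_nv -> 'cV[R]_d;
  cell : 'I_ncell -> 'I_d.+1 -> 'I_nv }.

Definition verts (R : realType) (d : nat) (T : mesh R d) (K : 'I_(ncell T))
    : {set 'I_(nv T)} :=
  [set cell K i | i : 'I_d.+1].

Definition simplex (R : realType) (d : nat) (T : mesh R d) (K : 'I_(ncell T))
    : set 'cV[R]_d :=
  conv_hull (@node R d T) (verts K).

Definition cell_node (R : realType) (d : nat) (T : mesh R d)
    (K : 'I_(ncell T)) (i : 'I_d.+1) : 'cV[R]_d :=
  node (cell K i).

Definition E_mx (R : realType) (d : nat) (T : mesh R d) (K : 'I_(ncell T))
    : 'M[R]_d :=
  edge_mx (cell_node K).

(** Volume of a simplex; the library has no Lebesgue measure on R^d. *)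
Definition volume (R : realType) (d : nat) (T : mesh R d) (K : 'I_(ncell T))
    : R :=
  `|\det (E_mx K)| / (d`!)%:R.

Definition q_vec (R : realType) (d : nat) (T : mesh R d) (K : 'I_(ncell T))
    (i : 'I_d.+1) : 'cV[R]_d :=
  let Q := (invmx (E_mx K))^T in
  match unlift ord0 i with
  | Some j => col j Q
  | None => - \sum_(j < d) col j Q
  end.

(** The condition on [simplex K `&` simplex L] is the conformity of the mesh:
    two simplices meet in a common (possibly empty) face. *)
Definition triangulation (R : realType) (d : nat) (Omega : set 'cV[R]_d)
    (T : mesh R d) : Prop :=
  [/\ injective (@node R d T) /\ injective (@verts R d T),
      (forall K : 'I_(ncell T), E_mx K \in unitmx) /\
        (forall i : 'I_(nv T), exists K : 'I_(ncell T), i \in verts K),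
      closure Omega = \bigcup_(K in [set: 'I_(ncell T)]) simplex K,
      (forall K L : 'I_(ncell T),
         simplex K `&` simplex L =
         conv_hull (@node R d T) (verts K :&: verts L)) &
      (nvi T <= nv T)%N /\
        (forall i : 'I_(nv T), (i < nvi T)%N <-> Omega (node i))].

(** * Finite element functions *)

Definition nodal_basis (R : realType) (d : nat) (Omega : set 'cV[R]_d)
    (T : mesh R d) (phi : 'I_(nv T) -> 'cV[R]_d -> R) : Prop :=
  forall j : 'I_(nv T),
    [/\ {within closure Omega, continuous (phi j)},
        forall K : 'I_(ncell T), affine_on (simplex K) (phi j) &
        forall i : 'I_(nv T), phi j (node i) = (i == j)%:R].

Definition fe_fun (R : realType) (d : nat) (T : mesh R d)
    (phi : 'I_(nv T) -> 'cV[R]_d -> R) (u : 'I_(nv T) -> R) : 'cV[R]_d -> R :=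
  fun x => \sum_(j < nv T) u j * phi j x.

Definition U0 (R : realType) (d : nat) (T : mesh R d)
    (phi : 'I_(nv T) -> 'cV[R]_d -> R) : set ('cV[R]_d -> R) :=
  [set v | exists c : 'I_(nv T) -> R,
     v = fun x => \sum_(j < nv T | (j < nvi T)%N) c j * phi j x].

Definition gradient (R : realType) (d : nat) (v : 'cV[R]_d -> R)
    (x : 'cV[R]_d) : 'cV[R]_d :=
  \col_i 'D_(delta_mx i 0) v x.

(** The constant gradient of v on K, read off at an interior point of K. *)
Definition grad_on (R : realType) (d : nat) (T : mesh R d) (K : 'I_(ncell T))
    (v : 'cV[R]_d -> R) : 'cV[R]_d :=
  gradient v ((d.+1)%:R^-1 *: \sum_(i < d.+1) cell_node K i).

(** * Quadrature *)

Record quadrature (R : realType) (d : nat) := Quadrature {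
  qsize : nat;
  qweight : 'I_qsize -> R;
  qnode : 'I_qsize -> 'cV[R]_d }.

(** Rule on the simplex with vertices [ahat].  The discrete maximum principle
    fails for rules with negative weights: the discrete load of f <= 0 can then
    be positive. *)
Definition quadrature_rule (R : realType) (d : nat)
    (ahat : 'I_d.+1 -> 'cV[R]_d) (Q : quadrature R d) : Prop :=
  [/\ forall k : 'I_(qsize Q), 0 <= qweight k,
      \sum_(k < qsize Q) qweight k = 1 &
      forall k : 'I_(qsize Q), conv_hull ahat finset.setT (qnode k)].

Definition reference_maps (R : realType) (d : nat) (T : mesh R d)
    (ahat : 'I_d.+1 -> 'cV[R]_d)
    (F : 'I_(ncell T) -> 'cV[R]_d -> 'cV[R]_d) : Prop :=
  forall K : 'I_(ncell T),
    affine_map (F K) /\ F K @` conv_hull ahat finset.setT = simplex K.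

Definition D_cell (R : realType) (d : nat) (T : mesh R d) (Q : quadrature R d)
    (F : 'I_(ncell T) -> 'cV[R]_d -> 'cV[R]_d) (D : 'cV[R]_d -> 'M[R]_d)
    (K : 'I_(ncell T)) : 'M[R]_d :=
  \sum_(k < qsize Q) qweight k *: D (F K (qnode k)).

(** * The scheme *)

Definition fe_solution (R : realType) (d : nat) (T : mesh R d)
    (phi : 'I_(nv T) -> 'cV[R]_d -> R) (Q : quadrature R d)
    (F : 'I_(ncell T) -> 'cV[R]_d -> 'cV[R]_d) (D : 'cV[R]_d -> 'M[R]_d)
    (f g : 'cV[R]_d -> R) (uh : 'cV[R]_d -> R) : Prop :=
  (exists u : 'I_(nv T) -> R, uh = fe_fun phi u /\
     forall j : 'I_(nv T), (nvi T <= j)%N -> u j = g (node j)) /\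
  forall v : 'cV[R]_d -> R, U0 phi v ->
    \sum_(K < ncell T) volume K *
      ((grad_on K v)^T *m D_cell Q F D K *m grad_on K uh) 0 0 =
    \sum_(K < ncell T) volume K *
      \sum_(k < qsize Q) qweight k * f (F K (qnode k)) * v (F K (qnode k)).

Definition discrete_maximum_principle (R : realType) (d : nat)
    (Omega : set 'cV[R]_d) (T : mesh R d)
    (phi : 'I_(nv T) -> 'cV[R]_d -> R) (Q : quadrature R d)
    (F : 'I_(ncell T) -> 'cV[R]_d -> 'cV[R]_d) (D : 'cV[R]_d -> 'M[R]_d)
    (f g : 'cV[R]_d -> R) : Prop :=
  (forall x, Omega x -> f x <= 0) ->
  forall uh : 'cV[R]_d -> R, fe_solution phi Q F D f g uh ->
  exists M B : R,
    [/\ is_maximum (uh @` (Omega `|` bdry Omega)) M,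
        is_maximum (uh @` bdry Omega) B &
        M <= Num.max 0 B].

Definition anisotropic_nonobtuse (R : realType) (d : nat) (T : mesh R d)
    (Q : quadrature R d) (F : 'I_(ncell T) -> 'cV[R]_d -> 'cV[R]_d)
    (D : 'cV[R]_d -> 'M[R]_d) : Prop :=
  forall (K : 'I_(ncell T)) (i j : 'I_d.+1), i != j ->
    ((q_vec K i)^T *m D_cell Q F D K *m q_vec K j) 0 0 <= 0.

(* Main.v *)
Require Import Defs.
From HB Require Import structures.
From mathcomp Require Import all_boot all_order all_algebra.
From mathcomp Require Import all_classical all_reals all_analysis.
From mathcomp Require Import ring lra.

(** On a cell K the gradient of a finite element function with vertex values
    [w] is [\sum_i w_i q_i] ([grad_on_fe_fun]), so the scheme is governed by
    the local matrices [A_ij = q_i^T D_K q_j].  The [q_i] sum to zero, hence so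
    do the rows of [A]; the angle condition says that the off-diagonal entries
    of [A] are nonpositive; and [D_K], an average of positive definite matrices
    with nonnegative weights of sum 1, is positive definite.

    Let [m] bound the boundary values of a solution [u], and test the scheme
    with the finite element function [v] whose vertex values are
    [max (0, u_j - m)]; it vanishes at the boundary vertices.  The signs in [A]
    give [v^T A v <= v^T A u] on each cell ([truncation_energy]), while the load
    is nonpositive because [f <= 0] and [v >= 0] ([load_le0]).  Thus the energy
    of [v] is zero, so [v] is constant on every cell.  If [v] were not zero,
    consider, among the vertices where [v] is maximal, one with the largest
    [r]-th coordinate.  It is an interior vertex, and an interior vertex always
    shares a cell with a higher one
    ([interior_vertex_has_higher_neighbour]), where [v] has the same value: a
    contradiction.  Hence [u <= m] at all vertices
    ([nodal_maximum_principle]), and everywhere, as [u] is a convex combination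
    of vertex values on each cell.

    Two points rest on the position of the mesh in the domain.  The bound
    [f <= 0] is known only inside the domain, while quadrature nodes may lie on
    its boundary; and the maximum over the boundary of the domain has to be
    compared with the values at the boundary vertices.  Both are settled by
    [open_star_interior]: a point of a cell at which some interior vertex has
    positive weight is in the domain, so on the boundary only boundary vertices
    have positive weight. *)

Set Implicit Arguments.
Unset Strict Implicit.
Unset Printing Implicit Defensive.

Import Order.TTheory GRing.Theory Num.Theory.
Import numFieldNormedType.Exports.

Local Open Scope classical_set_scope.
Local Open Scope ring_scope.

Local Notation dot x y := ((x^T *m y) 0 0).

(** * The scalar product *)

Lemma dot_suml (R : realType) (d : nat) (I : finType) (w : I -> R)
    (q : I -> 'cV[R]_d) (x : 'cV[R]_d) :
  dot (\sum_i w i *: q i) x = \sum_i w i * dot (q i) x.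
Proof.
rewrite linear_sum mulmx_suml summxE; apply: eq_bigr => i _.
by rewrite linearZ -scalemxAl mxE.
Qed.

Lemma dotZr (R : realType) (d : nat) (q x : 'cV[R]_d) (t : R) :
  dot q (t *: x) = t * dot q x.
Proof. by rewrite -scalemxAr mxE. Qed.

Lemma dotBr (R : realType) (d : nat) (q x y : 'cV[R]_d) :
  dot q (x - y) = dot q x - dot q y.
Proof. by rewrite mulmxBr !mxE. Qed.

Lemma dotr0 (R : realType) (d : nat) (q : 'cV[R]_d) : dot q (0 : 'cV[R]_d) = 0.
Proof. by rewrite mulmx0 mxE. Qed.

Lemma continuous_dot (R : realType) (d : nat) (q : 'cV[R]_d) :
  continuous (fun x : 'cV[R]_d => dot q x).
Proof.
have -> : (fun x : 'cV[R]_d => dot q x) = (fun x => \sum_k q k 0 * x k 0).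
  by apply/funext => x; rewrite mxE; apply: eq_bigr => k _; rewrite mxE.
apply: (@continuous_big _ _ +%R 0 xpredT (@add_continuous R)) => k _ x.
apply: (@continuousM _ _ (fun=> q k 0)); first exact: cst_continuous.
exact: coord_continuous.
Qed.

(** * The q-vectors as gradients of the barycentric coordinates *)

Lemma sum_q_vec (R : realType) (d : nat) (T : mesh R d) (K : 'I_(ncell T)) :
  \sum_i q_vec K i = 0.
Proof.
rewrite big_ord_recl /q_vec unlift_none.
under [X in _ + X]eq_bigr => i _ do rewrite liftK.
by rewrite addNr.
Qed.

Lemma sum_q_vec_dot (R : realType) (d : nat) (T : mesh R d)
    (K : 'I_(ncell T)) (x : 'cV[R]_d) : \sum_i dot (q_vec K i) x = 0.
Proof.
have /esym := dot_suml (fun=> 1) (q_vec K) x.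
under [in X in X = _ -> _]eq_bigr => i _ do rewrite mul1r.
under [in X in _ = X -> _]eq_bigr => i _ do rewrite scale1r.
by rewrite sum_q_vec trmx0 mul0mx [in X in _ = X -> _]mxE.
Qed.

Lemma q_vec_lift (R : realType) (d : nat) (T : mesh R d) (K : 'I_(ncell T))
    (i : 'I_d) (x : 'cV[R]_d) :
  dot (q_vec K (lift ord0 i)) x = (invmx (E_mx K) *m x) i 0.
Proof.
rewrite /q_vec liftK !mxE; apply: eq_bigr => k _.
by rewrite !mxE.
Qed.

(** [q_i] is the gradient of the [i]-th barycentric coordinate of K; the case
    [i = 0] follows from the others because the coordinates sum to 1. *)
Lemma q_vec_dual (R : realType) (d : nat) (T : mesh R d) (K : 'I_(ncell T))
    (i j : 'I_d.+1) : E_mx K \in unitmx ->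
  dot (q_vec K i) (cell_node K j - cell_node K ord0) =
    (i == j)%:R - (i == ord0)%:R.
Proof.
move=> uE.
set e := cell_node K j - _.
have dual0 (k : 'I_d) : dot (q_vec K (lift ord0 k)) e = (lift ord0 k == j)%:R.
  rewrite q_vec_lift /e; case: (unliftP ord0 j) => [l ->|->].
    have -> : cell_node K (lift ord0 l) - cell_node K ord0 = col l (E_mx K).
      by apply/matrixP => r s; rewrite !mxE ord1.
    by rewrite colE mulmxA mulVmx// mul1mx mxE eqxx andbT (inj_eq lift_inj).
  by rewrite subrr mulmx0 mxE eq_sym (negbTE (neq_lift _ _)).
case: (unliftP ord0 i) => [k ->|->].
  by rewrite dual0 [lift _ _ == ord0]eq_sym (negbTE (neq_lift _ _)) subr0.
have /(congr1 (fun q => dot q e)) := sum_q_vec K.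
rewrite big_ord_recl /= [X in X *m _]linearD mulmxDl mxE linear_sum mulmx_suml.
rewrite summxE trmx0 mul0mx [X in _ = X]mxE.
under [X in _ + X]eq_bigr => k _ do rewrite dual0.
move/eqP; rewrite addr_eq0 => /eqP ->.
case: (unliftP ord0 j) => [l ->|->].
  rewrite (negbTE (neq_lift _ _)) (bigD1 l)//= eqxx big1.
    by rewrite addr0 sub0r.
  by move=> k kl; rewrite (inj_eq lift_inj) (negbTE kl).
by rewrite eqxx subrr big1 ?oppr0.
Qed.

(** The increment [x] of a point changes its barycentric coordinates by
    [q_i^T x]. *)
Lemma q_vec_resolution (R : realType) (d : nat) (T : mesh R d)
    (K : 'I_(ncell T)) (x : 'cV[R]_d) : E_mx K \in unitmx ->
  \sum_i dot (q_vec K i) x *: cell_node K i = x.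
Proof.
move=> uE.
transitivity (\sum_i dot (q_vec K i) x *: (cell_node K i - cell_node K ord0)).
  under [RHS]eq_bigr => i _ do rewrite scalerBr.
  by rewrite sumrB -scaler_suml sum_q_vec_dot scale0r subr0.
rewrite big_ord_recl subrr scaler0 add0r -[RHS](mulKVmx uE).
apply/matrixP => r s; rewrite ord1 summxE mxE; apply: eq_bigr => i _.
by rewrite q_vec_lift mxE mulrC; congr (_ * _); rewrite !mxE.
Qed.

Lemma cell_inj (R : realType) (d : nat) (T : mesh R d) (K : 'I_(ncell T)) :
  E_mx K \in unitmx -> injective (cell K).
Proof.
move=> uE i j eij; apply/eqP; apply: contraT => nij.
have : dot (q_vec K i) (cell_node K i - cell_node K ord0) =
       dot (q_vec K i) (cell_node K j - cell_node K ord0).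
  by rewrite /cell_node eij.
by rewrite !q_vec_dual// eqxx (negbTE nij) => /addIr/eqP; rewrite oner_eq0.
Qed.

(** * Finite element functions on a cell *)

(** Passes from weights on a set of global vertex indices to weights on the
    local indices of the cell; the two agree because a nondegenerate cell lists
    each of its vertices once. *)
Lemma simplexP (R : realType) (d : nat) (T : mesh R d) (K : 'I_(ncell T))
    (x : 'cV[R]_d) : E_mx K \in unitmx ->
  simplex K x <->
  exists c : 'I_d.+1 -> R, [/\ forall i, 0 <= c i, \sum_i c i = 1 &
    x = \sum_i c i *: cell_node K i].
Proof.
move=> uE; have inj := cell_inj uE.
have sumE (V : zmodType) (G : 'I_(nv T) -> V) :
    \sum_(j in verts K) G j = \sum_i G (cell K i).
  by rewrite big_imset //= => i j _ _; exact: inj.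
split=> [[c [c0 c1 ->]]|[c [c0 c1 ->]]].
  by exists (c \o cell K); split=> [i||]; rewrite ?sumE//=; rewrite -sumE.
pose c' j := \sum_(i | cell K i == j) c i.
have c'E i : c' (cell K i) = c i.
  rewrite /c' (big_pred1 i)// => k; exact: inj_eq.
exists c'; split; first by move=> j; apply: sumr_ge0.
  by rewrite sumE -c1; apply: eq_bigr => i _.
by rewrite sumE; apply: eq_bigr => i _; rewrite c'E.
Qed.

Lemma cell_node_simplex (R : realType) (d : nat) (T : mesh R d)
    (K : 'I_(ncell T)) (i : 'I_d.+1) :
  E_mx K \in unitmx -> simplex K (cell_node K i).
Proof.
move=> uE; apply/simplexP => //.
exists (fun k => (i == k)%:R); split=> [k||]; first exact: ler0n.
  by rewrite (bigD1 i)//= eqxx big1 ?addr0// => k; rewrite eq_sym => /negbTE ->.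
rewrite (bigD1 i)//= eqxx scale1r big1 ?addr0// => k.
by rewrite eq_sym => /negbTE ->; rewrite scale0r.
Qed.

(** An affine function commutes with convex combinations, so the nodal values
    determine the basis function on the cell. *)
Lemma nodal_basis_on_cell (R : realType) (d : nat) (Omega : set 'cV[R]_d)
    (T : mesh R d) (phi : 'I_(nv T) -> 'cV[R]_d -> R) (K : 'I_(ncell T))
    (c : 'I_d.+1 -> R) (j : 'I_(nv T)) :
  nodal_basis Omega phi -> E_mx K \in unitmx ->
  (forall i, 0 <= c i) -> \sum_i c i = 1 ->
  phi j (\sum_i c i *: cell_node K i) = \sum_i c i * (cell K i == j)%:R.
Proof.
move=> hphi uE c0 c1; have [_ /(_ K)[G [b phiE]] phin] := hphi j.
have nodeE i : dot G (cell_node K i) + b = (cell K i == j)%:R.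
  by rewrite -phin -phiE//; exact: cell_node_simplex.
rewrite phiE; last by apply/simplexP => //; exists c.
rewrite mulmx_sumr summxE -[b]mul1r -[in LHS]c1 mulr_suml -big_split/=.
by apply: eq_bigr => i _; rewrite -scalemxAr mxE -mulrDr nodeE.
Qed.

Lemma fe_fun_on_cell (R : realType) (d : nat) (Omega : set 'cV[R]_d)
    (T : mesh R d) (phi : 'I_(nv T) -> 'cV[R]_d -> R) (K : 'I_(ncell T))
    (c : 'I_d.+1 -> R) (u : 'I_(nv T) -> R) :
  nodal_basis Omega phi -> E_mx K \in unitmx ->
  (forall i, 0 <= c i) -> \sum_i c i = 1 ->
  fe_fun phi u (\sum_i c i *: cell_node K i) = \sum_i c i * u (cell K i).
Proof.
move=> hphi uE c0 c1; rewrite /fe_fun.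
under eq_bigr => j _ do
  rewrite (nodal_basis_on_cell j hphi uE c0 c1) mulr_sumr.
rewrite exchange_big; apply: eq_bigr => i _ /=.
rewrite (bigD1 (cell K i))//= eqxx mulr1 mulrC big1 ?addr0// => j.
by rewrite eq_sym => /negbTE ->; rewrite !mulr0.
Qed.

Lemma gradient_affine (R : realType) (d : nat) (G b : 'cV[R]_d) (a : R)
    (v : 'cV[R]_d -> R) :
  (\forall y \near b, v y = a + dot G (y - b)) -> gradient v b = G.
Proof.
move=> vE; apply/matrixP => r s; rewrite ord1 mxE.
rewrite (near_eq_derive (delta_mx r 0) vE) /derive.
apply: cvg_lim => //; apply: cvg_near_cst; near=> h.
rewrite /= addrK subrr dotr0 addr0 addrC addKr dotZr.
rewrite /GRing.scale/= mulKf; last by near: h; exact: nbhs_dnbhs_neq.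
rewrite mxE (bigD1 r)//= !mxE !eqxx mulr1 big1 ?addr0// => k /negbTE kr.
by rewrite !mxE kr mulr0.
Unshelve. all: by end_near. Qed.

(** The barycentre has all weights equal to [1 / (d + 1)], so the nearby points
    still have positive weights and stay in K; there the finite element
    function is the affine function with the vertex values [u]. *)
Lemma grad_on_fe_fun (R : realType) (d : nat) (Omega : set 'cV[R]_d)
    (T : mesh R d) (phi : 'I_(nv T) -> 'cV[R]_d -> R) (K : 'I_(ncell T))
    (u : 'I_(nv T) -> R) :
  nodal_basis Omega phi -> E_mx K \in unitmx ->
  grad_on K (fe_fun phi u) = \sum_i u (cell K i) *: q_vec K i.
Proof.
move=> hphi uE; rewrite /grad_on; set b := _ *: _.
pose c y i : R := (d.+1)%:R^-1 + dot (q_vec K i) (y - b).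
have c1 y : \sum_i c y i = 1.
  rewrite big_split/= sumr_const card_ord -[X in X + _]mulr_natr.
  by rewrite mulVf ?pnatr_eq0// sum_q_vec_dot addr0.
have cE y : \sum_i c y i *: cell_node K i = y.
  under eq_bigr => i _ do rewrite scalerDl.
  by rewrite big_split/= q_vec_resolution// -scaler_sumr -/b addrC subrK.
apply: (@gradient_affine _ _ _ _ (\sum_i (d.+1)%:R^-1 * u (cell K i))).
have cpos : \forall y \near b, forall i, 0 < c y i.
  apply: (@filter_forall _ _ (fun i y => 0 < c y i) (nbhs b) _) => i.
  have : \forall y \near b,
      dot (q_vec K i) b - (d.+1)%:R^-1 < dot (q_vec K i) y.
    apply: (cvgr_gt _ (@continuous_dot _ _ (q_vec K i) b)).
    by rewrite ltrBlDr ltrDl invr_gt0 ltr0n.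
  by apply: filterS => y; rewrite /c dotBr ltrBlDr -subr_gt0 addrCA addrA.
near=> y.
rewrite -{1}[y]cE (fe_fun_on_cell u hphi uE) ?c1//; last first.
  by move=> i; apply/ltW; move: i; near: y.
rewrite dot_suml -big_split/=; apply: eq_bigr => i _.
by rewrite /c mulrDl [u _ * _]mulrC.
Unshelve. all: by end_near. Qed.

(** * Position of the interior vertices *)

(** The homothety of centre [a_k] and ratio [t] acts in the same way on points
    and on weights, [a_k] having the weights [i == k]. *)
Lemma sum_homothety (R : realType) (d n : nat) (t : R) (k : 'I_n)
    (c : 'I_n -> R) (a : 'I_n -> 'cV[R]_d) :
  \sum_i ((i == k)%:R + t * (c i - (i == k)%:R)) *: a i =
  a k + t *: (\sum_i c i *: a i - a k).
Proof.
have sumk : \sum_i (i == k)%:R *: a i = a k.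
  rewrite (bigD1 k)//= eqxx scale1r big1 ?addr0// => i /negbTE ->.
  by rewrite scale0r.
under eq_bigr => i _ do rewrite scalerDl -scalerA scalerBl.
by rewrite big_split/= -scaler_sumr sumrB sumk.
Qed.

Lemma sum_homothety_weights (R : realType) (n : nat) (t : R) (k : 'I_n)
    (c : 'I_n -> R) : \sum_i c i = 1 ->
  \sum_i ((i == k)%:R + t * (c i - (i == k)%:R)) = 1.
Proof.
move=> c1; have sumk : \sum_i (i == k)%:R = 1 :> R.
  by rewrite (bigD1 k)//= eqxx big1 ?addr0// => i /negbTE ->.
by rewrite big_split/= -mulr_sumr sumrB sumk c1 subrr mulr0 addr0.
Qed.

Lemma continuous_homothety (R : realType) (V : normedModType R) (a : V)
    (t : R) :
  continuous (fun y : V => a + t *: (y - a)).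
Proof.
move=> x; apply: cvgD; first exact: cvg_cst.
apply: cvgZl_tmp; apply: cvgB; [exact: cvg_id|exact: cvg_cst].
Qed.

Lemma continuous_segment (R : realType) (V : normedModType R) (a w : V) :
  continuous (fun t : R => a + t *: w).
Proof.
move=> t; apply: cvgD; first exact: cvg_cst.
by apply: cvgZr_tmp; exact: cvg_id.
Qed.

Lemma near_segment (R : realType) (V : normedModType R) (a w : V) (P : set V) :
  nbhs a P -> \forall t \near 0^'+, P (a + t *: w).
Proof.
move=> Pa; have := cvg_at_right_filter (@continuous_segment R V a w 0).
by rewrite /continuous_at scale0r addr0; apply.
Qed.

Lemma simplex_sub_closure (R : realType) (d : nat) (Omega : set 'cV[R]_d)
    (T : mesh R d) (K : 'I_(ncell T)) :
  triangulation Omega T -> simplex K `<=` closure Omega.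
Proof. by case=> _ _ -> _ _ x Kx; exists K. Qed.

Lemma triangulation_cover (R : realType) (d : nat) (Omega : set 'cV[R]_d)
    (T : mesh R d) (x : 'cV[R]_d) :
  triangulation Omega T -> closure Omega x ->
  exists (K : 'I_(ncell T)) (c : 'I_d.+1 -> R), [/\ forall i, 0 <= c i,
    \sum_i c i = 1 & x = \sum_i c i *: cell_node K i].
Proof.
case=> _ [uE _] -> _ _ [K _ /(simplexP _ (uE K)) [c cP]].
by exists K, c.
Qed.

Lemma nodal_basis_pos_vertex (R : realType) (d : nat) (Omega : set 'cV[R]_d)
    (T : mesh R d) (phi : 'I_(nv T) -> 'cV[R]_d -> R) (K : 'I_(ncell T))
    (c : 'I_d.+1 -> R) (j : 'I_(nv T)) :
  nodal_basis Omega phi -> E_mx K \in unitmx ->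
  (forall i, 0 <= c i) -> \sum_i c i = 1 ->
  0 < phi j (\sum_i c i *: cell_node K i) ->
  exists2 i, cell K i = j & phi j (\sum_i c i *: cell_node K i) = c i.
Proof.
move=> hphi uE c0 c1; rewrite (nodal_basis_on_cell j hphi uE c0 c1).
have [[i ij]|nj] := pselect (exists i, cell K i = j).
  move=> _; exists i => //; rewrite (bigD1 i)//= ij eqxx mulr1 big1 ?addr0//.
  by move=> k ki; rewrite -ij (inj_eq (cell_inj uE)) (negbTE ki) mulr0.
rewrite big1 ?ltxx// => i _; case: eqP => [ij|]; last by rewrite mulr0.
by case: nj; exists i.
Qed.

Lemma nodal_basis_continuous (R : realType) (d : nat) (Omega : set 'cV[R]_d)
    (T : mesh R d) (phi : 'I_(nv T) -> 'cV[R]_d -> R) (j : 'I_(nv T))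
    (x : 'cV[R]_d) :
  open Omega -> nodal_basis Omega phi -> Omega x -> {for x, continuous (phi j)}.
Proof.
move=> oO hphi Ox; have [phic _ _] := hphi j.
have := continuous_subspaceW (@subset_closure _ Omega) phic.
rewrite continuous_open_subspace// => /(_ x); apply; exact: mem_set.
Qed.

(** Shrink the cell towards its interior vertex [a] until the point [x] is moved
    inside the domain, to [h x].  If [y] is close to [x], then [h y] lies in
    some cell [L], and by continuity of the basis function of [a] its weight at
    [a] is still larger than [1 - s].  In particular [a] is a vertex of [L], and
    this is exactly the bound that keeps the weights nonnegative when [h] is
    undone.  So [y] is in [L], and a neighbourhood of [x] lies in the closure of
    the domain, whose interior is the domain. *)
Lemma open_star_interior (R : realType) (d : nat) (Omega : set 'cV[R]_d)
    (T : mesh R d) (phi : 'I_(nv T) -> 'cV[R]_d -> R) (K : 'I_(ncell T))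
    (c : 'I_d.+1 -> R) (k : 'I_d.+1) :
  interior (closure Omega) = Omega -> triangulation Omega T ->
  nodal_basis Omega phi ->
  (forall i, 0 <= c i) -> \sum_i c i = 1 -> 0 < c k ->
  Omega (cell_node K k) -> Omega (\sum_i c i *: cell_node K i).
Proof.
move=> rO hT hphi c0 c1 ck Ok; have [_ [uE _] _ _ _] := hT.
have oO : open Omega by rewrite -rO; exact: open_interior.
set a := cell_node K k in Ok *; set x := \sum_i _.
pose j := cell K k.
have [s [s0 s1 Os]] : exists s : R,
    [/\ 0 < s, s < 1 & Omega (a + s *: (x - a))].
  have : \forall s \near 0^'+, [/\ 0 < s, s < 1 & Omega (a + s *: (x - a))].
    near=> s; split; near: s; first exact: nbhs_right_gt.
      exact: nbhs_right_lt.
    by apply: near_segment; exact: open_nbhs_nbhs.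
  by move/filter_ex.
pose h y := a + s *: (y - a).
pose w (i : 'I_d.+1) := (i == k)%:R + s * (c i - (i == k)%:R).
have w0 i : 0 <= w i.
  have sc : 0 <= s * c i by rewrite mulr_ge0// ltW.
  by rewrite /w; case: (i == k) => /=; lra.
have hxE : h x = \sum_i w i *: cell_node K i by rewrite sum_homothety.
(* The weight of [h x] at [a] is [1 - s + s * c k]. *)
have phix : 1 - s < phi j (h x).
  rewrite hxE (nodal_basis_on_cell j hphi (uE K) w0) ?sum_homothety_weights//.
  rewrite (bigD1 k)//= eqxx mulr1 big1 ?addr0; last first.
    by move=> i ik; rewrite (inj_eq (cell_inj (uE K))) (negbTE ik) mulr0.
  have sc : 0 < s * c k by rewrite mulr_gt0.
  by rewrite /w eqxx /=; lra.
have hc : {for x, continuous h} by exact: continuous_homothety.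
have near1 : \forall y \near x, Omega (h y).
  by apply: hc; exact: open_nbhs_nbhs.
have near2 : \forall y \near x, 1 - s < phi j (h y).
  apply: (hc [set z | 1 - s < phi j z]).
  apply: (cvgr_gt _ (nodal_basis_continuous oO hphi Os)).
  exact: phix.
rewrite -rO; apply: filterS2 near1 near2 => y Ohy phiy.
have [L [mu [mu0 mu1 hyE]]] := triangulation_cover hT (subset_closure Ohy).
have phiy0 : 0 < phi j (h y) by lra.
rewrite hyE in phiy phiy0.
have [l lj phiE] := nodal_basis_pos_vertex hphi (uE L) mu0 mu1 phiy0.
rewrite phiE in phiy.
have alE : cell_node L l = a by rewrite /cell_node lj.
have yE : y = cell_node L l + s^-1 *: (h y - cell_node L l).
  rewrite alE /h [a + s *: _]addrC addrK scalerA mulVf ?gt_eqF// scale1r.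
  by rewrite addrC subrK.
apply: (@simplex_sub_closure _ _ _ _ L) => //; apply/simplexP => //.
exists (fun i => (i == l)%:R + s^-1 * (mu i - (i == l)%:R)).
split; last 2 first.
- by rewrite sum_homothety_weights.
- by rewrite sum_homothety -hyE.
have sV : 0 < s^-1 by rewrite invr_gt0.
move=> i; have [->|il] := eqVneq i l; last first.
  by rewrite add0r subr0 mulr_ge0// ltW.
have -> : 1 + s^-1 * (mu l - 1) = s^-1 * (mu l - (1 - s)).
  by field; rewrite gt_eqF.
by rewrite mulr_ge0// ?ltW// subr_gt0.
Unshelve. all: by end_near. Qed.

(** A point slightly above [node j] lies in a cell in which [node j] has
    positive weight, by continuity of its basis function; if no vertex of that
    cell were higher than [node j], no convex combination of them would be. *)
Lemma interior_vertex_has_higher_neighbour (R : realType) (d : nat)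
    (Omega : set 'cV[R]_d) (T : mesh R d) (phi : 'I_(nv T) -> 'cV[R]_d -> R)
    (j : 'I_(nv T)) (r : 'I_d) :
  open Omega -> triangulation Omega T -> nodal_basis Omega phi ->
  Omega (node j) ->
  exists (K : 'I_(ncell T)) (k l : 'I_d.+1),
    cell K k = j /\ node j r 0 < cell_node K l r 0.
Proof.
move=> oO hT hphi Oj; have [_ [uE _] _ _ _] := hT.
have [t [t0 Ot phit]] : exists t : R, [/\ 0 < t,
    Omega (node j + t *: delta_mx r 0) &
    0 < phi j (node j + t *: delta_mx r 0)].
  have : \forall t \near 0^'+, [/\ 0 < t, Omega (node j + t *: delta_mx r 0) &
    0 < phi j (node j + t *: delta_mx r 0)].
    near=> t; split; near: t; first exact: nbhs_right_gt.
      by apply: near_segment; exact: open_nbhs_nbhs.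
    apply: (@near_segment _ _ (node j) (delta_mx r 0) [set y | 0 < phi j y]).
    apply: (cvgr_gt _ (nodal_basis_continuous oO hphi Oj)).
    by have [_ _ ->] := hphi j; rewrite eqxx.
  by move/filter_ex.
have [K [c [c0 c1 yE]]] := triangulation_cover hT (subset_closure Ot).
have phit' := phit; rewrite yE in phit'.
have [k kj _] := nodal_basis_pos_vertex hphi (uE K) c0 c1 phit'.
have [[l jl]|nl] := pselect (exists l, node j r 0 < cell_node K l r 0).
  by exists K, k, l.
have : (node j + t *: delta_mx r 0) r 0 <= node j r 0.
  rewrite yE summxE -[leRHS]mul1r -c1 mulr_suml; apply: ler_sum => i _.
  rewrite mxE ler_wpM2l// leNgt; apply/negP => ji; apply: nl; by exists i.
by rewrite !mxE !eqxx mulr1 gerDl leNgt t0.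
Unshelve. all: by end_near. Qed.

(** * Local energies *)

(** Since the rows of [A] sum to zero, [u] may be replaced by [u - m].  Then
    [v - (u - m)] is the negative part of [u - m]: its product with [v] is zero
    on the diagonal, and off the diagonal the signs decide. *)
Lemma truncation_energy (R : realType) (I : finType) (A : I -> I -> R)
    (u v : I -> R) (m : R) :
  (forall i, v i = Num.max 0 (u i - m)) ->
  (forall i j, i != j -> A i j <= 0) -> (forall i, \sum_j A i j = 0) ->
  \sum_i \sum_j v i * A i j * v j <= \sum_i \sum_j v i * A i j * u j.
Proof.
move=> vE Aoff Arow; apply: ler_sum => i _.
have -> : \sum_j v i * A i j * u j = \sum_j v i * A i j * (u j - m).
  under [RHS]eq_bigr => j _ do rewrite mulrBr.
  by rewrite sumrB -mulr_suml -mulr_sumr Arow mulr0 mul0r subr0.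
apply: ler_sum => j _.
have [<-{j}|ij] := eqVneq i j.
  by rewrite vE; case: (leP 0 (u i - m)) => // _; rewrite !mul0r.
apply: ler_wnM2l; last by rewrite vE le_max lexx orbT.
by apply: mulr_ge0_le0; [rewrite vE le_max lexx|exact: Aoff].
Qed.

Lemma quadratic_form_sum (R : realType) (d : nat) (I : finType) (D : 'M[R]_d)
    (v u : I -> R) (q : I -> 'cV[R]_d) :
  dot (\sum_i v i *: q i) (D *m \sum_i u i *: q i) =
  \sum_i \sum_j v i * dot (q i) (D *m q j) * u j.
Proof.
rewrite dot_suml; apply: eq_bigr => i _.
rewrite !mulmx_sumr summxE mulr_sumr; apply: eq_bigr => j _.
by rewrite -!scalemxAr mxE -mulrA; congr (_ * _); rewrite mulrC.
Qed.

(** The [q_i] have only one linear relation, that their sum is zero. *)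
Lemma gradient0_const (R : realType) (d : nat) (T : mesh R d)
    (K : 'I_(ncell T)) (w : 'I_d.+1 -> R) (i j : 'I_d.+1) :
  E_mx K \in unitmx -> \sum_k w k *: q_vec K k = 0 -> w i = w j.
Proof.
move=> uE w0; suff w0E l : w l = w ord0 by rewrite !w0E.
have := dot_suml w (q_vec K) (cell_node K l - cell_node K ord0).
rewrite w0 trmx0 mul0mx mxE.
under eq_bigr => k _ do rewrite q_vec_dual// mulrBr.
have pick k' : \sum_k w k * (k == k')%:R = w k'.
  rewrite (bigD1 k')//= eqxx mulr1 big1 ?addr0// => k /negbTE ->.
  by rewrite mulr0.
by rewrite sumrB !pick => /esym/eqP; rewrite subr_eq0 => /eqP.
Qed.

Lemma volume_gt0 (R : realType) (d : nat) (T : mesh R d) (K : 'I_(ncell T)) :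
  E_mx K \in unitmx -> 0 < volume K.
Proof.
rewrite unitmxE unitfE => detE.
by rewrite divr_gt0 ?normr_gt0// ltr0n fact_gt0.
Qed.

(** The weights are nonnegative and sum to 1, so one of them is positive. *)
Lemma D_cell_posdef (R : realType) (d : nat) (T : mesh R d)
    (ahat : 'I_d.+1 -> 'cV[R]_d) (Q : quadrature R d)
    (F : 'I_(ncell T) -> 'cV[R]_d -> 'cV[R]_d) (D : 'cV[R]_d -> 'M[R]_d)
    (K : 'I_(ncell T)) (x : 'cV[R]_d) :
  quadrature_rule ahat Q ->
  (forall k : 'I_(qsize Q), spd (D (F K (qnode k)))) ->
  x != 0 -> 0 < dot x (D_cell Q F D K *m x).
Proof.
case=> w0 w1 _ Dspd x0.
have Dx (k : 'I_(qsize Q)) : 0 < dot x (D (F K (qnode k)) *m x).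
  by rewrite mulmxA; have [_] := Dspd k; apply.
have -> : dot x (D_cell Q F D K *m x) =
    \sum_(k < qsize Q) qweight k * dot x (D (F K (qnode k)) *m x).
  rewrite /D_cell mulmx_suml mulmx_sumr summxE; apply: eq_bigr => k _.
  by rewrite -scalemxAl dotZr.
have t0 (k : 'I_(qsize Q)) :
    true -> 0 <= qweight k * dot x (D (F K (qnode k)) *m x).
  by move=> _; rewrite mulr_ge0// ltW.
rewrite lt_def sumr_ge0// andbT; apply/eqP => s0.
apply: (negP (oner_neq0 R)); rewrite -w1 big1// => k _; apply/eqP.
have /eqP := @psumr_eq0P _ _ xpredT _ t0 s0 k isT.
by rewrite mulf_eq0 [X in _ || X]gt_eqF ?orbF.
Qed.

Lemma sum_stiffness_row (R : realType) (d : nat) (T : mesh R d)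
    (K : 'I_(ncell T)) (D : 'M[R]_d) (x : 'cV[R]_d) :
  \sum_j dot x (D *m q_vec K j) = 0.
Proof. by rewrite -summxE -mulmx_sumr -mulmx_sumr sum_q_vec mulmx0 dotr0. Qed.

(** * The discrete maximum principle *)

Lemma fe_fun_node (R : realType) (d : nat) (Omega : set 'cV[R]_d)
    (T : mesh R d) (phi : 'I_(nv T) -> 'cV[R]_d -> R) (u : 'I_(nv T) -> R)
    (i : 'I_(nv T)) : nodal_basis Omega phi -> fe_fun phi u (node i) = u i.
Proof.
move=> hphi; rewrite /fe_fun.
under eq_bigr => j _ do (have [_ _ ->] := hphi j).
rewrite (bigD1 i)//= eqxx mulr1 big1 ?addr0// => j.
by rewrite eq_sym => /negbTE ->; rewrite mulr0.
Qed.

Lemma node_closure (R : realType) (d : nat) (Omega : set 'cV[R]_d)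
    (T : mesh R d) (j : 'I_(nv T)) :
  triangulation Omega T -> closure Omega (node j).
Proof.
move=> hT; have [_ [uE /(_ j)[K /imsetP[i _ ->]]] _ _ _] := hT.
apply: (@simplex_sub_closure _ _ _ _ K) => //; exact: cell_node_simplex.
Qed.

Lemma fe_fun_U0 (R : realType) (d : nat) (T : mesh R d)
    (phi : 'I_(nv T) -> 'cV[R]_d -> R) (v : 'I_(nv T) -> R) :
  (forall j : 'I_(nv T), (nvi T <= j)%N -> v j = 0) -> U0 phi (fe_fun phi v).
Proof.
move=> vb; exists v; apply/funext => x; rewrite [RHS]big_mkcond.
apply: eq_bigr => j _; case: ltnP => // /vb ->.
by rewrite mul0r.
Qed.

Lemma interior_vertex_weight0 (R : realType) (d : nat)
    (Omega : set 'cV[R]_d) (T : mesh R d) (phi : 'I_(nv T) -> 'cV[R]_d -> R)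
    (K : 'I_(ncell T)) (c : 'I_d.+1 -> R) :
  interior (closure Omega) = Omega -> triangulation Omega T ->
  nodal_basis Omega phi ->
  (forall i, 0 <= c i) -> \sum_i c i = 1 ->
  ~ Omega (\sum_i c i *: cell_node K i) ->
  forall i, (cell K i < nvi T)%N -> c i = 0.
Proof.
move=> rO hT hphi c0 c1 nO i ii; have [_ _ _ _ [_ nviE]] := hT.
have := c0 i; rewrite le_eqVlt => /orP[/eqP //|ci].
by case: nO; apply: (open_star_interior rO hT hphi c0 c1 ci); apply/nviE.
Qed.

(** At a quadrature node on the boundary of the domain nothing is known about
    [f], but there the interior vertices have weight zero, so the test function
    vanishes. *)
Lemma load_le0 (R : realType) (d : nat) (Omega : set 'cV[R]_d) (T : mesh R d)
    (phi : 'I_(nv T) -> 'cV[R]_d -> R) (ahat : 'I_d.+1 -> 'cV[R]_d)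
    (F : 'I_(ncell T) -> 'cV[R]_d -> 'cV[R]_d) (Q : quadrature R d)
    (f : 'cV[R]_d -> R) (v : 'I_(nv T) -> R) :
  interior (closure Omega) = Omega -> triangulation Omega T ->
  nodal_basis Omega phi -> reference_maps ahat F -> quadrature_rule ahat Q ->
  (forall x, Omega x -> f x <= 0) -> (forall j, 0 <= v j) ->
  (forall j : 'I_(nv T), (nvi T <= j)%N -> v j = 0) ->
  \sum_(K < ncell T) volume K * \sum_(k < qsize Q)
    qweight k * f (F K (qnode k)) * fe_fun phi v (F K (qnode k)) <= 0.
Proof.
move=> rO hT hphi hF [w0 _ wn] f0 v0 vb; have [_ [uE _] _ _ _] := hT.
apply: sumr_le0 => K _; apply: mulr_ge0_le0; first exact/ltW/volume_gt0.
apply: sumr_le0 => k _; rewrite -mulrA; apply: mulr_ge0_le0 => //.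
have : simplex K (F K (qnode k)).
  by have [_ <-] := hF K; exists (qnode k).
move=> /(simplexP _ (uE K))[c [c0 c1 xE]].
rewrite {2}xE (fe_fun_on_cell v hphi (uE K) c0 c1).
have [Ox|nO] := pselect (Omega (F K (qnode k))).
  by apply: mulr_le0_ge0; [exact: f0|apply: sumr_ge0 => i _; exact: mulr_ge0].
rewrite big1 ?mulr0// => i _; case: (ltnP (cell K i) (nvi T)) => [ii|/vb ->].
  rewrite xE in nO.
  by rewrite (interior_vertex_weight0 rO hT hphi c0 c1 nO ii) mul0r.
by rewrite mulr0.
Qed.

(** The energy only shows that the test function is constant on each cell.
    Comparing vertices along the coordinate [r] then plays the part of a walk
    through neighbouring cells up to the boundary. *)
Lemma nodal_maximum_principle (R : realType) (d : nat) (Omega : set 'cV[R]_d)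
    (T : mesh R d) (phi : 'I_(nv T) -> 'cV[R]_d -> R)
    (ahat : 'I_d.+1 -> 'cV[R]_d) (F : 'I_(ncell T) -> 'cV[R]_d -> 'cV[R]_d)
    (Q : quadrature R d) (D : 'cV[R]_d -> 'M[R]_d) (f g : 'cV[R]_d -> R)
    (u : 'I_(nv T) -> R) (m : R) (r : 'I_d) :
  interior (closure Omega) = Omega -> triangulation Omega T ->
  nodal_basis Omega phi -> reference_maps ahat F -> quadrature_rule ahat Q ->
  (forall (K : 'I_(ncell T)) (k : 'I_(qsize Q)), spd (D (F K (qnode k)))) ->
  anisotropic_nonobtuse Q F D -> (forall x, Omega x -> f x <= 0) ->
  fe_solution phi Q F D f g (fe_fun phi u) ->
  (forall j : 'I_(nv T), (nvi T <= j)%N -> u j <= m) ->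
  forall j, u j <= m.
Proof.
move=> rO hT hphi hF hQ hD hA f0 [_ usol] um.
have [_ [uE _] _ _ [_ nviE]] := hT.
have oO : open Omega by rewrite -rO; exact: open_interior.
pose v j := Num.max 0 (u j - m).
have v0 j : 0 <= v j by rewrite le_max lexx.
have vb (j : 'I_(nv T)) : (nvi T <= j)%N -> v j = 0.
  by move=> /um ujm; apply/max_idPl; rewrite subr_le0.
pose E K w z := dot (grad_on K (fe_fun phi w))
  (D_cell Q F D K *m grad_on K (fe_fun phi z)).
have EE K w z : E K w z = \sum_i \sum_j w (cell K i) *
    dot (q_vec K i) (D_cell Q F D K *m q_vec K j) * z (cell K j).
  by rewrite /E !(grad_on_fe_fun _ hphi (uE K)) quadratic_form_sum.
have Evv K : E K v v <= E K v u.
  rewrite !EE; apply: (@truncation_energy _ _ _ (u \o cell K) _ m) => //.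
    by move=> i j ij; rewrite mulmxA; exact: hA.
  by move=> i; exact: sum_stiffness_row.
have Evv_ge0 K : 0 <= E K v v.
  have [g0|gn0] := eqVneq (grad_on K (fe_fun phi v)) 0.
    by rewrite /E g0 mulmx0 dotr0.
  exact/ltW/(D_cell_posdef hQ).
have energy_le0 : \sum_(K < ncell T) volume K * E K v v <= 0.
  apply: le_trans (load_le0 rO hT hphi hF hQ f0 v0 vb).
  rewrite -usol; last exact: fe_fun_U0.
  apply: ler_sum => K _; rewrite -mulmxA ler_wpM2l//; exact/ltW/volume_gt0.
have Evv0 K : E K v v = 0.
  have t0 L : true -> 0 <= volume L * E L v v.
    by move=> _; rewrite mulr_ge0//; exact/ltW/volume_gt0.
  have s0 : \sum_(K < ncell T) volume K * E K v v = 0.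
    by apply/le_anti; rewrite energy_le0 sumr_ge0.
  have /eqP := @psumr_eq0P _ _ xpredT _ t0 s0 K isT.
  by rewrite mulf_eq0 gt_eqF ?volume_gt0// => /eqP.
have vconst K i j : v (cell K i) = v (cell K j).
  apply: (@gradient0_const _ _ _ K (v \o cell K)) => //=.
  rewrite -(grad_on_fe_fun v hphi (uE K)).
  apply/eqP; apply: contraT => gn0.
  have := @D_cell_posdef _ _ T _ _ F D K _ hQ (hD K) gn0.
  by rewrite -/(E K v v) Evv0 ltxx.
move=> j0; rewrite leNgt; apply/negP => uj0.
(* Maximizing [v] first and the height second leaves no vertex above [j2] in
   the cells around it, as [v] is constant there. *)
have [j1 _ j1max] := @arg_maxP _ _ _ j0 xpredT v isT.
have [j2 /eqP vj2 j2max] :=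
  @arg_maxP _ _ _ j1 (fun j => v j == v j1) (fun j => node j r 0) (eqxx _).
have Oj2 : Omega (node j2).
  apply/nviE; rewrite ltnNge; apply/negP => /vb; rewrite vj2 => v1.
  have := j1max j0 isT; rewrite /= v1 leNgt lt_max subr_gt0 uj0.
  by rewrite orbT.
have [K [k [l [kj2]]]] := interior_vertex_has_higher_neighbour r oO hT hphi Oj2.
rewrite ltNge => /negP; apply; apply: j2max.
by rewrite (vconst K l k) kj2 vj2.
Qed.

Theorem theorem2p1 (R : realType) (d : nat) (hd : (1 <= d <= 3)%N)
  (Omega : set 'cV[R]_d) (hOmega : polyhedral_domain Omega)
  (T : mesh R d) (hT : triangulation Omega T)
  (phi : 'I_(nv T) -> 'cV[R]_d -> R) (hphi : nodal_basis Omega phi)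
  (ahat : 'I_d.+1 -> 'cV[R]_d) (hahat : edge_mx ahat \in unitmx)
  (F : 'I_(ncell T) -> 'cV[R]_d -> 'cV[R]_d) (hF : reference_maps ahat F)
  (Q : quadrature R d) (hQ : quadrature_rule ahat Q)
  (D : 'cV[R]_d -> 'M[R]_d) (hD : forall x, Omega x -> spd (D x))
  (* quadrature nodes may lie on the boundary of Omega *)
  (hDnode : forall (K : 'I_(ncell T)) (k : 'I_(qsize Q)),
     spd (D (F K (qnode k))))
  (f g : 'cV[R]_d -> R) :
  anisotropic_nonobtuse Q F D ->
  discrete_maximum_principle Omega phi Q F D f g.
Proof.
move=> hA f0 uh uhsol; have [[u [uhE _]] _] := uhsol.
rewrite {}uhE in uhsol *.
have [[x0 Ox0] _ rO _] := hOmega; have [_ [uE _] _ _ [_ nviE]] := hT.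
have oO : open Omega by rewrite -rO; exact: open_interior.
have r : 'I_d by case/andP: hd => d0 _; exact: Ordinal d0.
have bdryE : bdry Omega = closure Omega `\` Omega.
  by rewrite /bdry; have /interior_id -> := oO.
have [K0 _] := triangulation_cover hT (subset_closure Ox0).
(* A highest vertex of the mesh is a boundary vertex. *)
have [b0 b0b] : exists b : 'I_(nv T), (nvi T <= b)%N.
  have [b _ bmax] :=
    @arg_maxP _ _ _ (cell K0 ord0) xpredT (fun j => node j r 0) isT.
  exists b; rewrite leqNgt; apply/negP => /nviE Ob.
  have [K [k [l [_]]]] := interior_vertex_has_higher_neighbour r oO hT hphi Ob.
  by rewrite ltNge => /negP; apply; exact: bmax.
have [b bb bmax] :=
  @arg_maxP _ _ _ b0 (fun j : 'I_(nv T) => nvi T <= j)%N u b0b.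
have [j _ jmax] := @arg_maxP _ _ _ b0 xpredT u isT.
exists (u j), (u b); split.
- rewrite bdryE setDUK; last exact: subset_closure.
  split; first by exists (node j); [exact: node_closure|exact: fe_fun_node].
  move=> _ [x Ox <-]; have [K [c [c0 c1 ->]]] := triangulation_cover hT Ox.
  rewrite (fe_fun_on_cell u hphi (uE K) c0 c1) -[leRHS]mul1r -c1 mulr_suml.
  by apply: ler_sum => i _; rewrite ler_wpM2l//; exact: jmax.
- rewrite bdryE; split.
    exists (node b); last exact: fe_fun_node.
    by split; [exact: node_closure|move/nviE; rewrite ltnNge bb].
  move=> _ [x [Ox nOx] <-].
  have [K [c [c0 c1 xE]]] := triangulation_cover hT Ox.
  rewrite xE in nOx *.
  rewrite (fe_fun_on_cell u hphi (uE K) c0 c1) -[leRHS]mul1r -c1 mulr_suml.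
  apply: ler_sum => i _; case: (ltnP (cell K i) (nvi T)) => ii.
    by rewrite (interior_vertex_weight0 rO hT hphi c0 c1 nOx ii) !mul0r.
  by rewrite ler_wpM2l//; exact: bmax.
rewrite le_max; apply/orP; right.
exact: (nodal_maximum_principle r rO hT hphi hF hQ hDnode hA f0 uhsol).
Qed.
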